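(* Let $q$ be an odd prime power, $\delta\in\mathbb{F}_{q^2}$ and $\gamma\in\mathbb{F}_q^*$. Then the polynomial $$f(x)=(x^q-x+\delta)^{q+2}+\gamma(x^q+x)$$ is a permutation polynomial of $\mathbb{F}_{q^2}$ if and only if either $q\equiv0\pmod 3$, or $q\equiv2\pmod 3$ and $\mathrm{Tr}_q^{q^2}(\delta)=0$.
   Context: A polynomial over a finite field $\mathbb{F}$ is a permutation polynomial of $\mathbb{F}$ if the map it induces on $\mathbb{F}$ is a bijection. For $x\in\mathbb{F}_{q^2}$, $\mathrm{Tr}_q^{q^2}(x)=x+x^q$. *)

(* Defs.v *)
From HB Require Import structures.
From mathcomp Require Import all_boot all_order all_algebra all_field.

Set Implicit Arguments.
Unset Strict Implicit.
Unset Printing Implicit Defensive.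

Import GRing.Theory.
Local Open Scope ring_scope.

Definition odd_prime_power (q : nat) : Prop :=
  odd q /\ exists p k : nat, [/\ prime p, (0 < k)%N & q = (p ^ k)%N].

Definition permutation_polynomial (F : finFieldType) (f : {poly F}) : Prop :=
  bijective (fun x : F => f.[x]).

(* The relative trace to F_q, for F of order q ^ 2, with values viewed in F. *)
Definition trace_q2 (F : finFieldType) (q : nat) (x : F) : F := x + x ^+ q.

(* K is a subfield of F with q elements, i.e. the copy of F_q inside F. *)
Definition subfield_of_order (F : finFieldType) (q : nat) (K : {pred F}) : Prop :=
  GRing.divring_closed K /\ #|K| = q.

(* Main.v *)
Require Import Defs.
From mathcomp Require Import all_boot all_order all_algebra all_field.
From mathcomp Require Import ring zify.

Import GRing.Theory.
Local Open Scope ring_scope.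

(** Put [a = Tr(delta) / 2], [w = x^q - x + (delta - delta^q) / 2] and
    [t = x^q + x].  Then [x] corresponds bijectively to [(w, t)], where [t] lies
    in [F_q] and [w] in the space [S] of elements of trace zero, and
    [f(x) = ((a^2 - w^2) a + gamma t) + (a^2 - w^2) w]
    is the decomposition of [f(x)] along [F_q] and [S].  Since [t] is free in the
    first component, [f] is a permutation iff the cubic [(a^2 - w^2) w] is
    injective on [S], i.e. iff [w^2 + w v + v^2 = a^2] has no solution with
    [w != v] in [S].  In characteristic 3 the left side is [(w - v)^2]; for
    [a = 0] solutions come from primitive cube roots of unity in [F_q]; for
    [a != 0] outside characteristic 3 a pigeonhole argument on
    [3 p^2 + d^2 = a^2] always gives one. *)

(** * Counting in finite fields *)

Lemma card_expr_fixed_le (F : finFieldType) (n : nat) :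
  (1 < n)%N -> (#|[set x : F | x ^+ n == x]| <= n)%N.
Proof.
move=> n_gt1.
have sz : size ('X^n - 'X : {poly F}) = n.+1.
  by rewrite size_polyDl size_polyXn // size_polyN size_polyX ltnS.
have nz : 'X^n - 'X != 0 :> {poly F} by rewrite -size_poly_eq0 sz.
rewrite cardE -ltnS -sz; apply: max_poly_roots nz _ (enum_uniq _).
by apply/allP => x; rewrite mem_enum inE rootE !hornerE subr_eq0.
Qed.

(** Multiplication by [x != 0] permutes the nonzero elements of [K]; comparing the product of all of
    them before and after gives [x ^+ (#|K| - 1) = 1]. *)
Lemma divring_closed_expr_card (F : finFieldType) (K : {pred F}) (x : F) :
  GRing.divring_closed K -> x \in K -> x ^+ #|K| = x.
Proof.
move=> [K1 KB Kdiv] Kx.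
have K0 : 0 \in K by rewrite -(subrr 1) KB.
have KV y : y \in K -> y^-1 \in K by move=> Ky; rewrite -(mul1r y^-1) Kdiv.
have KM y z : y \in K -> z \in K -> y * z \in K.
  by move=> Ky Kz; rewrite -(invrK z) Kdiv // KV.
have [->|x0] := eqVneq x 0.
  by rewrite expr0n (cardD1 0) K0.
pose P := \prod_(y in K | y != 0) y.
have P0 : P != 0 by apply/prodf_neq0 => y /andP[].
have PE : P = x ^+ #|[pred y in K | y != 0]| * P.
  rewrite -prodr_const -big_split /= {1}/P.
  rewrite (reindex_onto (fun y => x * y) (fun y => x^-1 * y)) /=; last first.
    by move=> y _; rewrite mulVKf.
  apply: eq_bigl => y; rewrite mulKf // eqxx andbT mulf_eq0 (negPf x0) /=.
  congr andb; apply/idP/idP => [Kxy|]; last exact: KM.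
  by rewrite -(mulKf x0 y) KM ?KV.
have x1 : x ^+ #|[pred y in K | y != 0]| = 1.
  by apply: (mulIf P0); rewrite -PE mul1r.
rewrite (cardD1 0) K0 exprS.
have -> : #|[predD1 K & 0]| = #|[pred y in K | y != 0]|.
  by apply: eq_card => y; rewrite !inE andbC.
by rewrite x1 mulr1.
Qed.

(** Squaring is at most two-to-one: chosen square roots and their negatives cover [S]. *)
Lemma card_le_double_sqr (F : finFieldType) (S : {set F}) :
  (#|S| <= (#|[set s ^+ 2 | s in S]|).*2)%N.
Proof.
pose r (b : F) : F := odflt 0 [pick s | s ^+ 2 == b].
have sub : S \subset r @: [set s ^+ 2 | s in S] :|:
                     (fun b => - r b) @: [set s ^+ 2 | s in S].
  apply/subsetP => s Ss.
  have Bs : s ^+ 2 \in [set s ^+ 2 | s in S] by apply: imset_f.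
  have : (r (s ^+ 2)) ^+ 2 = s ^+ 2.
    by rewrite /r; case: pickP => [y /eqP //|/(_ s)]; rewrite eqxx.
  move/eqP; rewrite eq_sym eqf_sqr inE => /orP[] /eqP e; apply/orP; [left|right].
    by rewrite {1}e imset_f.
  by rewrite {1}e (imset_f (fun b => - r b)).
apply: leq_trans (subset_leq_card sub) _.
apply: leq_trans (leq_card_setU _ _) _.
by rewrite -addnn leq_add ?leq_imset_card.
Qed.

Lemma pigeonhole (T : finType) (A B C : {set T}) :
  A \subset C -> B \subset C -> (#|C| < #|A| + #|B|)%N ->
  exists2 x, x \in A & x \in B.
Proof.
move=> AC BC; rewrite -cardsUI => lt.
have : (0 < #|A :&: B|)%N.
  have : (#|A :|: B| <= #|C|)%N by rewrite subset_leq_card // subUset AC.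
  lia.
by case/card_gt0P => x; rewrite inE => /andP[]; exists x.
Qed.

(** * The two eigenspaces of Frobenius on the quadratic extension *)

Section QuadraticExtension.

Variables (F : finFieldType) (q : nat).
Hypothesis q_odd : odd q.
Hypothesis q_gt1 : (1 < q)%N.
Hypothesis q_pchar : [pchar F].-nat q.
Hypothesis cardF : #|F| = (q ^ 2)%N.

Let fixq := [set x : F | x ^+ q == x].
(** The kernel of the relative trace, called [S] in the overview. *)
Let antiq := [set x : F | x ^+ q == - x].

Hypothesis card_fixq : #|fixq| = q.

Let frobD (x y : F) : (x + y) ^+ q = x ^+ q + y ^+ q.
Proof. exact: exprDn_pchar. Qed.

Let frobN (x : F) : (- x) ^+ q = - x ^+ q.
Proof. exact: exprNn_pchar. Qed.

Let frobB (x y : F) : (x - y) ^+ q = x ^+ q - y ^+ q.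
Proof. by rewrite frobD frobN. Qed.

Let frobK (x : F) : (x ^+ q) ^+ q = x.
Proof. by rewrite -exprM -[(q * q)%N]/(q ^ 2)%N -cardF expf_card. Qed.

Let frob_nat (n : nat) : (n%:R : F) ^+ q = n%:R.
Proof.
elim: n => [|n IH]; first by rewrite expr0n gtn_eqF // ltnW.
by rewrite -addn1 natrD frobD IH expr1n.
Qed.

Lemma two_neq0 : 2%:R != 0 :> F.
Proof.
have [p p_pr charF] := finPcharP F.
rewrite -(dvdn_pcharf charF) dvdn_prime2 //; apply/eqP => p2.
have pq : p.-nat q by rewrite -(eq_pnat _ (pcharf_eq charF)).
move: pq; rewrite p2 => /p_natP [[|k] qE]; first by move: q_gt1; rewrite qE.
by move: q_odd; rewrite qE oddX.
Qed.

Lemma fixq_antiq_eq0 (x : F) : x \in fixq -> x \in antiq -> x = 0.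
Proof.
rewrite !inE => /eqP -> /eqP e; apply/eqP.
have : 2%:R * x == 0 by rewrite mulr2n mulrDl mul1r {1}e addNr.
by rewrite mulf_eq0 (negPf two_neq0).
Qed.

(** Frobenius is an involution, so it negates [x ^+ q - x], which is nonzero for [x] outside
    [fixq]. *)
Lemma antiq_neq0 : exists2 e, e \in antiq & e != 0.
Proof.
have : (#|fixq| < #|[set: F]|)%N.
  by rewrite cardsT card_fixq cardF -{1}(expn1 q) ltn_exp2l.
have [sub|/subsetPn [x _]] := boolP ([set: F] \subset fixq).
  by rewrite ltnNge subset_leq_card.
rewrite inE => xq _; exists (x ^+ q - x); last by rewrite subr_eq0.
by rewrite inE frobB frobK opprB.
Qed.

(** Multiplication by a nonzero element of [antiq] embeds [fixq] into [antiq]. *)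
Lemma card_antiq_ge : (q <= #|antiq|)%N.
Proof.
have [e] := antiq_neq0; rewrite inE => /eqP eS e0.
rewrite -{1}card_fixq -(card_imset (mem fixq) (mulfI e0)) subset_leq_card //.
apply/subsetP => _ /imsetP[x + ->]; rewrite !inE => /eqP xq.
by rewrite exprMn eS xq mulNr.
Qed.

Lemma antiq_sqr (x : F) : x \in antiq -> x ^+ 2 \in fixq.
Proof. by rewrite !inE => /eqP e; rewrite exprAC e sqrrN. Qed.

(** Substituting [w = p + d], [v = p - d] turns the form into [3 p^2 + d^2]. With [B] the squares of
    [antiq], the sets [3 B] and [a^2 - B] both lie in [fixq] and each fills more than half of it, so
    they meet. *)
Lemma antiq_conic_point (a : F) :
  3%:R != 0 :> F -> a \in fixq ->
  exists w v, [/\ w \in antiq, v \in antiq & w ^+ 2 + w * v + v ^+ 2 = a ^+ 2].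
Proof.
move=> n3; rewrite inE => /eqP aK.
pose B := [set s ^+ 2 | s in antiq].
have cardB : (q < (#|B|).*2)%N.
  have le : (q <= (#|B|).*2)%N.
    exact: leq_trans card_antiq_ge (card_le_double_sqr _ _).
  (* The bound is strict because [q] is odd. *)
  rewrite ltn_neqAle le andbT; apply/eqP => qE.
  by move: q_odd; rewrite qE odd_double.
have BK b : b \in B -> b ^+ q = b.
  by case/imsetP => s /antiq_sqr; rewrite inE => /eqP + ->.
have sub1 : (fun b => 3%:R * b) @: B \subset fixq.
  apply/subsetP => _ /imsetP[b /BK bq ->].
  by rewrite inE exprMn frob_nat bq.
have sub2 : (fun b => a ^+ 2 - b) @: B \subset fixq.
  apply/subsetP => _ /imsetP[b /BK bq ->].
  by rewrite inE frobB bq exprAC aK.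
have inj2 : injective (fun b : F => a ^+ 2 - b) by move=> x y /addrI /oppr_inj.
have [|x] := pigeonhole _ _ _ _ sub1 sub2.
  by rewrite card_fixq (card_imset _ (mulfI n3)) (card_imset _ inj2) addnn.
move=> /imsetP[_ /imsetP[p pS ->] ->] /imsetP[_ /imsetP[d dS ->] e].
move: pS dS; rewrite !inE => /eqP pS /eqP dS.
exists (p + d), (p - d); split; rewrite ?inE ?frobB ?frobD ?pS ?dS.
- by rewrite opprD.
- by rewrite opprB opprK addrC.
- by apply/eqP; rewrite -subr_eq0 -(subrr (3%:R * p ^+ 2)) {2}e; apply/eqP; ring.
Qed.

(** * Injectivity of the cubic on the trace-zero space *)

Let cubic (a w : F) : F := (a ^+ 2 - w ^+ 2) * w.

Let cubicB (a w v : F) :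
  cubic a w - cubic a v = (w - v) * (a ^+ 2 - (w ^+ 2 + w * v + v ^+ 2)).
Proof. by rewrite /cubic; ring. Qed.

(** A conic point gives [w] and [v] with equal values; should they coincide, [w] and [-2 w] collide
    instead, and they differ because [a != 0]. *)
Lemma cubic_noninjective (a : F) :
  3%:R != 0 :> F -> a \in fixq -> a != 0 -> ~ {in antiq &, injective (cubic a)}.
Proof.
move=> n3 aK a0 inj.
have [w [v [wS vS e]]] := antiq_conic_point a n3 aK.
have wv : w = v by apply: inj => //; apply/eqP; rewrite -subr_eq0 cubicB e subrr mulr0.
(* A double root [w] of the cubic forces the third root to be [-2 w]. *)
have w2S : - 2%:R * w \in antiq.
  by move: wS; rewrite !inE exprMn frobN frob_nat => /eqP ->; rewrite mulrN.
have : w = - 2%:R * w.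
  apply: inj => //; apply/eqP; rewrite -subr_eq0 cubicB -e -wv.
  by apply/eqP; ring.
move/eqP; rewrite -subr_eq0 (_ : _ - _ = 3%:R * w); last by ring.
rewrite mulf_eq0 (negPf n3) /= => /eqP w0.
by move: e; rewrite -wv w0 => /esym/eqP; rewrite mul0r expr0n !addr0 sqrf_eq0 (negPf a0).
Qed.

(** With [q = 3 m + 1], the equation [x^(m+1) = x] has at most [m + 1 < q] roots, so some [x] in
    [fixq] violates it; then [x^m] is the required root of unity. *)
Lemma fixq_cube_root_of_unity :
  (q %% 3 = 1)%N -> exists z : F, [/\ z \in fixq, z != 1 & z ^+ 3 = 1].
Proof.
move=> q3; pose m := (q %/ 3)%N.
have qE : q = (m * 3).+1 by rewrite [LHS](divn_eq q 3) q3 addn1.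
have m0 : (0 < m)%N by move: q_gt1; rewrite qE; case: (m).
have [sub|/subsetPn[x]] := boolP (fixq \subset [set x : F | x ^+ m.+1 == x]).
  have := leq_trans (subset_leq_card sub) (card_expr_fixed_le F m.+1 m0).
  by rewrite card_fixq; lia.
rewrite !inE => /eqP xq xm.
have x0 : x != 0 by apply: contraNneq xm => ->; rewrite expr0n.
exists (x ^+ m); rewrite inE; split.
- by rewrite exprAC xq.
- by apply: contraNneq xm => xm1; rewrite exprS xm1 mulr1.
- by apply: (mulfI x0); rewrite -exprM -exprS -qE mulr1.
Qed.

Lemma cubic0_noninjective :
  (q %% 3 = 1)%N -> ~ {in antiq &, injective (cubic 0)}.
Proof.
move=> q3 inj.
have [z [zK z1 z3]] := fixq_cube_root_of_unity q3.
have [e eS e0] := antiq_neq0.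
have : z * e = e.
  apply: inj => //.
    by move: zK eS; rewrite !inE exprMn => /eqP -> /eqP ->; rewrite mulrN.
  rewrite /cubic expr0n !sub0r !mulNr -!exprSr.
  by rewrite exprMn z3 mul1r.
by rewrite -{2}(mul1r e) => /(mulIf e0)/eqP; rewrite (negPf z1).
Qed.

(** If [w] and [v != 0] have equal cubes, the ratio [w / v] lies in [fixq] and its cube is 1; as 3
    does not divide [q - 1], it equals 1. *)
Lemma cubic0_injective :
  (q %% 3 = 2)%N -> {in antiq &, injective (cubic 0)}.
Proof.
move=> q3 w v; rewrite !inE /cubic => /eqP wS /eqP vS.
rewrite expr0n !sub0r !mulNr -!exprSr => /oppr_inj e.
have [v0|v0] := eqVneq v 0.
  by move/eqP: e; rewrite v0 expr0n expf_eq0 => /eqP.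
have r3 : (w / v) ^+ 3 = 1 by rewrite expr_div_n e divff // expf_neq0.
have rq : (w / v) ^+ q = w / v by rewrite expr_div_n wS vS invrN mulrNN.
have r1 : w / v = 1.
  have r0 : w / v != 0.
    by apply/eqP => r0; move/eqP: r3; rewrite r0 expr0n eq_sym oner_eq0.
  (* Since [q] is 2 modulo 3, [(w / v)^q] reduces to [(w / v)^2]. *)
  move: rq; rewrite (divn_eq q 3) q3 exprD mulnC exprM r3 expr1n mul1r.
  by rewrite expr2 => /(canRL (mulfK r0)); rewrite divff.
by rewrite -(divfK v0 w) r1 mul1r.
Qed.

(** A collision with [w != v] would give [a^2 = (w - v)^2], so [a] and [w - v] agree up to sign and
    lie in both eigenspaces, which meet only in 0. *)
Lemma cubic_injective_pchar3 (a : F) :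
  3%:R = 0 :> F -> a \in fixq -> {in antiq &, injective (cubic a)}.
Proof.
move=> n3 aK w v wS vS /eqP; rewrite -subr_eq0 cubicB.
have -> : a ^+ 2 - (w ^+ 2 + w * v + v ^+ 2) =
          a ^+ 2 - (w - v) ^+ 2 - 3%:R * (w * v) by ring.
rewrite n3 mul0r subr0 mulf_eq0 !subr_eq0 => /orP[/eqP // |].
have wvS : w - v \in antiq.
  by move: wS vS; rewrite !inE frobB => /eqP -> /eqP ->; rewrite opprB opprK addrC.
rewrite eqf_sqr => /orP[] /eqP aE; apply/eqP; rewrite -subr_eq0; apply/eqP.
  by apply: fixq_antiq_eq0; rewrite // -aE.
apply: fixq_antiq_eq0; rewrite // -(opprK (w - v)) -aE.
by move: aK; rewrite !inE frobN => /eqP ->.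
Qed.

Lemma cubic_injective_iff (a : F) :
  a \in fixq ->
  {in antiq &, injective (cubic a)} <->
  (q = 0 %[mod 3] \/ (q = 2 %[mod 3] /\ a = 0)).
Proof.
move=> aK.
(* [q] is a positive power of the characteristic, so 3 vanishes in [F] exactly when it divides
   [q]. *)
have n3E : (3%:R == 0 :> F) = (q %% 3 == 0)%N.
  have [p p_pr charF] := finPcharP F.
  have pq : p.-nat q by rewrite -(eq_pnat _ (pcharf_eq charF)).
  rewrite -(dvdn_pcharf charF) dvdn_prime2 //.
  case/p_natP: pq => -[|k] qE; first by move: q_gt1; rewrite qE.
  by rewrite -/(dvdn 3 q) qE Euclid_dvdX // andbT dvdn_prime2 // eq_sym.
rewrite mod0n [(2 %% 3)%N]/=.
have q3 : [\/ (q %% 3 = 0)%N, (q %% 3 = 1)%N | (q %% 3 = 2)%N].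
  by have := ltn_pmod q (isT : 0 < 3)%N; case: (q %% 3)%N => [|[|[|?]]] //;
    [constructor 1 | constructor 2 | constructor 3].
split=> [inj|[q0|[q2 ->]]]; last exact: cubic0_injective.
  have [n3|n3] := eqVneq (3%:R : F) 0.
    by left; apply/eqP; rewrite -n3E n3.
  have a0 : a = 0 by apply/eqP/negP => /negP a0; apply: cubic_noninjective inj.
  case: q3 => q3; [by left | | by right].
  by case: (cubic0_noninjective q3); rewrite -a0.
by apply: cubic_injective_pchar3 => //; apply/eqP; rewrite n3E q0.
Qed.

(** * Reduction of the permutation property to the cubic *)

Section Permutation.

Variables (delta gamma : F).
Hypothesis gamma_fixq : gamma \in fixq.
Hypothesis gamma_neq0 : gamma != 0.

(** [delta = a + d0] is the decomposition of [delta] along [fixq] and [antiq]. *)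
Let a : F := trace_q2 q delta / 2%:R.
Let d0 : F := (delta - delta ^+ q) / 2%:R.
Let f : {poly F} := ('X^q - 'X + delta%:P) ^+ (q + 2) + gamma *: ('X^q + 'X).
Let w (x : F) : F := x ^+ q - x + d0.

Let half_fixq : (2%:R : F)^-1 ^+ q = 2%:R^-1.
Proof. by rewrite exprVn frob_nat. Qed.

Let a_fixq : a \in fixq.
Proof. by rewrite inE /a /trace_q2 exprMn half_fixq frobD frobK [_ + delta]addrC. Qed.

Let d0_antiq : d0 \in antiq.
Proof. by rewrite inE /d0 exprMn half_fixq frobB frobK -mulNr opprB. Qed.

Let w_antiq (x : F) : w x \in antiq.
Proof.
move: d0_antiq; rewrite !inE /w frobD frobB frobK => /eqP ->.
by rewrite opprD opprB.
Qed.

(** The base of the power is [a + w], and its Frobenius image is [a - w]; hence the power is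
    [(a - w) (a + w)^2 = (a^2 - w^2) (a + w)]. *)
Let hornerf (x : F) :
  f.[x] = (a ^+ 2 - w x ^+ 2) * a + gamma * (x ^+ q + x) + cubic a (w x).
Proof.
have yE : x ^+ q - x + delta = a + w x.
  by rewrite /w /a /d0 /trace_q2; field; exact: two_neq0.
have yq : (a + w x) ^+ q = a - w x.
  rewrite frobD; move: a_fixq (w_antiq x).
  by rewrite !inE => /eqP -> /eqP ->.
have -> : f.[x] = (x ^+ q - x + delta) ^+ (q + 2) + gamma * (x ^+ q + x).
  by rewrite !hornerE.
by rewrite yE exprD yq /cubic; ring.
Qed.

Let hornerf_frob (x : F) :
  f.[x] ^+ q = (a ^+ 2 - w x ^+ 2) * a + gamma * (x ^+ q + x) - cubic a (w x).
Proof.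
have tq : (x ^+ q + x) ^+ q = x ^+ q + x by rewrite frobD frobK addrC.
rewrite hornerf /cubic; move: a_fixq (w_antiq x) gamma_fixq.
move: (x ^+ q + x) (w x) a tq => t v b tq; rewrite !inE => /eqP bq /eqP vq /eqP gq.
rewrite !frobD !exprMn !frobB ![(_ ^+ 2) ^+ q]exprAC tq bq vq gq; ring.
Qed.

Lemma permutation_iff_cubic_injective :
  permutation_polynomial f <-> {in antiq &, injective (cubic a)}.
Proof.
split=> [/bij_inj inj u v uS vS uv | inj].
  (* [pre s] is the point with [w = s] and [(a^2 - s^2) a + gamma t = 0]. *)
  pose t s : F := - gamma^-1 * ((a ^+ 2 - s ^+ 2) * a).
  pose pre s : F := (t s - (s - d0)) / 2%:R.
  have tK s : s \in antiq -> (t s) ^+ q = t s.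
    rewrite /t; move: a a_fixq gamma_fixq => b; rewrite !inE => /eqP bq /eqP gq /eqP sq.
    by rewrite !exprMn frobN frobB exprVn ![(_ ^+ 2) ^+ q]exprAC gq bq sq sqrrN.
  (* Frobenius fixes [t s] and negates [s - d0]. *)
  have preq s : s \in antiq -> (pre s) ^+ q = (t s + (s - d0)) / 2%:R.
    move=> sS; rewrite /pre exprMn half_fixq !frobB tK //.
    move: sS d0_antiq; rewrite !inE => /eqP -> /eqP ->.
    by congr (_ / _); ring.
  have wpre s : s \in antiq -> w (pre s) = s.
    by move=> sS; rewrite /w preq // /pre; field; exact: two_neq0.
  have fpre s : s \in antiq -> f.[pre s] = cubic a s.
    move=> sS; rewrite hornerf wpre // preq // /pre /t.
    by field; rewrite gamma_neq0 two_neq0.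
  rewrite -(wpre u uS) -(wpre v vS); congr w; apply: inj.
  by rewrite !fpre.
apply: injF_bij => x y fxy.
(* The cubic is the [antiq] component, recovered from [f.[x] - f.[x] ^+ q]. *)
have cxy : cubic a (w x) = cubic a (w y).
  apply: (mulfI two_neq0).
  have twice z : 2%:R * cubic a (w z) = f.[z] - f.[z] ^+ q.
    by rewrite hornerf_frob hornerf; ring.
  by rewrite !twice fxy.
have wxy := inj _ _ (w_antiq x) (w_antiq y) cxy.
(* Once [w] agrees, the [fixq] components give equal [x ^+ q + x]; sum and difference then determine
   [x], as 2 is invertible. *)
have txy : x ^+ q + x = y ^+ q + y.
  by apply: (mulfI gamma_neq0); move: fxy; rewrite !hornerf wxy => /addIr/addrI.
have uxy : x ^+ q - x = y ^+ q - y by move: wxy => /addIr.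
apply: (mulfI two_neq0).
have twice (z : F) : 2%:R * z = (z ^+ q + z) - (z ^+ q - z) by ring.
by rewrite !twice txy uxy.
Qed.

Lemma permutation_iff :
  permutation_polynomial f <->
  (q = 0 %[mod 3] \/ (q = 2 %[mod 3] /\ trace_q2 q delta = 0)).
Proof.
have aE : a = 0 <-> trace_q2 q delta = 0.
  rewrite /a; split=> [/eqP|->]; last by rewrite mul0r.
  by rewrite mulf_eq0 invr_eq0 (negPf two_neq0) orbF => /eqP.
rewrite -aE -(cubic_injective_iff a a_fixq).
exact: permutation_iff_cubic_injective.
Qed.

End Permutation.

End QuadraticExtension.

(** * From the given subfield to the fixed points of Frobenius *)

Theorem theorem3p14 (q : nat) (F : finFieldType) (Fq : {pred F})
    (delta gamma : F)
    (hq : odd_prime_power q)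
    (hF : #|F| = (q ^ 2)%N)
    (hFq : subfield_of_order q Fq)
    (hgamma : gamma \in Fq)
    (hgamma0 : gamma != 0) :
  permutation_polynomial
    (('X^q - 'X + delta%:P) ^+ (q + 2) + gamma *: ('X^q + 'X) : {poly F})
  <->
  (q = 0 %[mod 3] \/ (q = 2 %[mod 3] /\ trace_q2 q delta = 0)).
Proof.
case: hq => q_odd [p [k [p_pr k_gt0 qE]]].
case: hFq => FqD cardFq.
have q_gt1 : (1 < q)%N by rewrite qE -(exp1n k) ltn_exp2r ?prime_gt1.
have charF : p \in [pchar F].
  by apply: (@card_finPcharP _ _ (k * 2)) p_pr; rewrite hF qE expnM.
have q_pchar : [pchar F].-nat q.
  by rewrite (eq_pnat _ (pcharf_eq charF)) qE pnatX pnat_id.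
have Fq_fix x : x \in Fq -> x \in [set x : F | x ^+ q == x].
  by move=> Kx; rewrite inE -cardFq divring_closed_expr_card.
apply: permutation_iff => //; last exact: Fq_fix.
(* The fixed points number at most [q] and contain the [q] elements of [Fq]. *)
apply/eqP; rewrite eqn_leq card_expr_fixed_le //= -{1}cardFq.
by apply: subset_leq_card; apply/subsetP.
Qed.
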